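(* Let $p\geqslant 1$, and consider two agents with Borda utilities, where the preference orders of the agents are independent and uniformly distributed over all $p!$ orders of the $p$ items (full independence). Then the alternating policy $\pi^*_p=1212\ldots$ of length $p$ maximizes the expected utilitarian social welfare: for every policy $\pi\in\{1,2\}^p$, $$\overline{\mathrm{sw}}(\pi)\leqslant\overline{\mathrm{sw}}(\pi^*_p).$$
   Context: There are $p$ indivisible items and $n$ agents (here $n=2$). Each agent has a strict total preference order over the items; a profile $R$ is an $n$-tuple of such orders. All agents share the same utility function: an item in $k$-th position of an agent's order ($k=1$ is most preferred) has utility $g(k)$ for that agent; for Borda utilities $g(k)=p-k+1$. The utility of a set of items is the sum of the individual utilities. A policy is a sequence $\pi=\pi_1\ldots\pi_p\in\{1,\ldots,n\}^p$; at step $k$ agent $\pi_k$ picks one of the remaining items, namely the one she ranks highest among the remaining items. $u_R(i,\pi)$ is the total utility obtained by agent $i$ for profile $R$, $\overline{u_i}(\pi)$ is the expectation of $u_R(i,\pi)$ over random profiles, and $\overline{\mathrm{sw}}(\pi)=\sum_{i=1}^n\overline{u_i}(\pi)$ is the expected utilitarian social welfare. *)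

(* Defs.v *)
From mathcomp Require Import all_boot all_order all_algebra all_fingroup.

Set Implicit Arguments.
Unset Strict Implicit.
Unset Printing Implicit Defensive.

Import Order.TTheory GRing.Theory Num.Theory.
Local Open Scope ring_scope.

(* A strict total order on the items 'I_p is encoded as the permutation sending
   each item to its 0-based position, so that [r o1 < r o2] means that o1 is
   preferred to o2. This is a bijection with the p! strict total orders. *)
Definition pref (p : nat) := {perm 'I_p}.

Definition position (p : nat) (r : pref p) (o : 'I_p) : nat := (r o).+1.

Definition profile (n p : nat) := {ffun 'I_n -> pref p}.

Definition policy (n p : nat) := p.-tuple 'I_n.

(* Always [Some _] on a nonempty set. *)
Definition top_item (p : nat) (r : pref p) (S : {set 'I_p}) : option 'I_p :=
  [pick o in S | [forall o' in S, position r o <= position r o']%N].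

(* [bundle R i S s] is what agent i gets when the agents in s pick, in turn,
   from the remaining items S. *)
Fixpoint bundle (n p : nat) (R : profile n p) (i : 'I_n) (S : {set 'I_p})
    (s : seq 'I_n) : {set 'I_p} :=
  if s is j :: s' then
    if top_item (R j) S is Some o then
      (if j == i then [set o] else set0) :|: bundle R i (S :\ o) s'
    else set0
  else set0.

Definition utility (n p : nat) (g : nat -> rat) (R : profile n p) (i : 'I_n)
    (pi : policy n p) : rat :=
  \sum_(o in bundle R i [set: 'I_p] pi) g (position (R i) o).

Definition expectation (n p : nat) (mu : profile n p -> rat)
    (X : profile n p -> rat) : rat :=
  \sum_(R : profile n p) mu R * X R.

Definition expected_utility (n p : nat) (mu : profile n p -> rat)
    (g : nat -> rat) (i : 'I_n) (pi : policy n p) : rat :=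
  expectation mu (fun R => utility g R i pi).

Definition expected_sw (n p : nat) (mu : profile n p -> rat)
    (g : nat -> rat) (pi : policy n p) : rat :=
  \sum_(i < n) expected_utility mu g i pi.

(* Probability mass function of n independent orders, each uniform over the p!
   orders. *)
Definition full_independence (n p : nat) (R : profile n p) : rat :=
  \prod_(i < n) (p`!)%:R^-1.

Definition borda (p k : nat) : rat := p%:R - k%:R + 1.

(* The two agents 1, 2 are the elements 0, 1 of 'I_2. *)
Definition alternating (p : nat) : policy 2 p :=
  [tuple inord (k %% 2) | k < p].

(* Main.v *)
(* Give the agent who picks with k items left the update x -> k/(k+1) * (1 + x)
   of an initial x = 0, reading the policy from the end: this computes [share],
   and the expected Borda utility of agent i is (p+1) * share i. Indeed the rank
   of a picked item in the order of an agent is independent of the relative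
   order of the remaining items; for the picker it is 0, and for the others it is
   uniform, so that a pick multiplies the future utility of a non-picking agent
   by (m+1)/m when m items remain before the pick.
   It remains to maximise a * share 1 + b * share 2. If b <= a one may assume
   that agent 1 picks first: by induction the only other case is a policy 2 1 s,
   and 1 2 s or 1 2 s' does at least as well, where s' is s with the agents
   exchanged. A first pick of agent 1 scales a by k/(k+1), and the condition
   k/(k+1) * a <= b <= a, which is preserved up to exchanging the agents, forces
   the alternation. *)
Require Import Defs.
From mathcomp Require Import all_boot all_order all_algebra all_fingroup.
From mathcomp Require Import ring lra.

Set Implicit Arguments.
Unset Strict Implicit.
Unset Printing Implicit Defensive.

Import Order.TTheory GRing.Theory Num.Theory.
Local Open Scope ring_scope.

(** * Shares, and ranks relative to a set of items *)

Definition shrink (k : nat) : rat := k%:R / k.+1%:R.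

Fixpoint share (n : nat) (i : 'I_n) (s : seq 'I_n) : rat :=
  if s is j :: s' then
    if j == i then shrink (size s) * (1 + share i s') else share i s'
  else 0.

Definition rank_in p (r : pref p) (S : {set 'I_p}) (o : 'I_p) : nat :=
  #|[set x in S | (r x < r o)%N]|.

Definition agree_on p (S : {set 'I_p}) (r r' : pref p) : Prop :=
  {in S &, forall x y, (r x < r y)%N = (r' x < r' y)%N}.

Lemma rank_in_setT p (r : pref p) o : rank_in r setT o = r o.
Proof.
rewrite /rank_in -sum1dep_card.
under eq_bigl => x do rewrite inE /=.
rewrite -(reindex_inj (@perm_inj _ r) (P := fun y : 'I_p => (y < r o)%N) (F := fun=> 1%N)).
by rewrite -(big_ord_widen _ (fun=> 1%N) (ltnW (ltn_ord _))) sum1_card card_ord.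
Qed.

Lemma rank_in_lt p (r : pref p) (S : {set 'I_p}) o :
  o \in S -> (rank_in r S o < #|S|)%N.
Proof.
move=> oS; apply: proper_card; apply/properP; split.
  by apply/subsetP => x; rewrite inE => /andP[].
by exists o => //; rewrite inE ltnn andbF.
Qed.

Lemma rank_in_mono p (r : pref p) (S : {set 'I_p}) x y : x \in S ->
  (rank_in r S x < rank_in r S y)%N = (r x < r y)%N.
Proof.
move=> xS; case: (ltnP (r x) (r y)) => xy.
  apply: proper_card; apply/properP; split; last first.
    by exists x; rewrite inE ?xS // ltnn andbF.
  by apply/subsetP => z; rewrite !inE => /andP[-> /ltn_trans->].
apply/negbTE; rewrite -leqNgt; apply: subset_leq_card.
by apply/subsetP => z; rewrite !inE => /andP[-> /leq_trans->].
Qed.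

Lemma rank_in_inj p (r : pref p) (S : {set 'I_p}) :
  {in S &, injective (rank_in r S)}.
Proof.
move=> x y xS yS e; apply: (@perm_inj _ r); apply: ord_inj; apply/eqP.
by rewrite eqn_leq; apply/andP; split; rewrite leqNgt -(rank_in_mono r (S := S)) // e ltnn.
Qed.

Arguments rank_in_inj {p} r {S} [x y].

Lemma rank_in_surj p (r : pref p) (S : {set 'I_p}) q : (q < #|S|)%N ->
  exists2 o, o \in S & rank_in r S o = q.
Proof.
case m_eq: #|S| => [//|m] qm.
have f_inj: {in S &, injective (fun o => inord (rank_in r S o) : 'I_m.+1)}.
  move=> x y xS yS /(congr1 val); rewrite /= !inordK -?m_eq ?rank_in_lt //.
  exact: rank_in_inj.
have: inord q \in [set (inord (rank_in r S o) : 'I_m.+1) | o in S].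
  have /eqP-> : [set (inord (rank_in r S o) : 'I_m.+1) | o in S] == setT.
    by rewrite eqEcard subsetT cardsT card_ord card_in_imset // m_eq leqnn.
  by rewrite inE.
case/imsetP => o oS /(congr1 val); rewrite /= !inordK // -?m_eq ?rank_in_lt //.
by move=> ->; exists o.
Qed.

Lemma rank_inD1 p (r : pref p) (S : {set 'I_p}) o x : o \in S ->
  rank_in r S x = ((r o < r x) + rank_in r (S :\ o) x)%N.
Proof.
move=> oS; rewrite /rank_in (cardsD1 o) inE oS /=; congr (_ + _)%N.
by apply: eq_card => y; rewrite !inE andbA.
Qed.

Lemma agree_on_rank_in p (S : {set 'I_p}) (r r' : pref p) o :
  agree_on S r r' -> o \in S -> rank_in r S o = rank_in r' S o.
Proof.
move=> rr' oS; apply: eq_card => x; rewrite !inE.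
by case xS: (x \in S); rewrite //= rr'.
Qed.

Lemma rank_in_mul p (t : {perm 'I_p}) (r : pref p) (S : {set 'I_p}) x :
  (forall y, (t y \in S) = (y \in S)) ->
  rank_in (t * r)%g S x = rank_in r S (t x).
Proof.
move=> tS; rewrite /rank_in -(card_imset _ (@perm_inj _ t)).
apply: eq_card => y; rewrite -[y](permKV t) mem_imset ?inE ?tS; last first.
  exact: perm_inj.
by rewrite !permM permKV.
Qed.

(** * Exchanging items of adjacent ranks, and uniformity of the rank of an item *)

Definition item_at p (q : nat) (S : {set 'I_p}) (r : pref p) : option 'I_p :=
  [pick o in S | rank_in r S o == q].

(** The transposition acts on items before [r], so [a] and [b] trade positions and all other items
    stay put. The branches returning [r] do not occur when [q.+1 < #|S|]. *)
Definition swap_ranks p (q : nat) (S : {set 'I_p}) (r : pref p) : pref p :=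
  if item_at q S r is Some a then
    if item_at q.+1 S r is Some b then (tperm a b * r)%g else r
  else r.

Lemma item_atE p q (S : {set 'I_p}) (r : pref p) o :
  o \in S -> rank_in r S o = q -> item_at q S r = Some o.
Proof.
move=> oS oq; rewrite /item_at; case: pickP => [x /andP[xS /eqP xq]|/(_ o)].
  by rewrite (rank_in_inj r xS oS) ?xq.
by rewrite oS oq eqxx.
Qed.

Section SwapRanks.
Variables (p q : nat) (S : {set 'I_p}).
Hypothesis qS : (q.+1 < #|S|)%N.

Lemma swap_ranksP (r : pref p) : exists a b,
  [/\ a \in S, b \in S, rank_in r S a = q, rank_in r S b = q.+1 &
      swap_ranks q S r = (tperm a b * r)%g].
Proof.
have [a aS aq] := rank_in_surj r (ltnW qS).
have [b bS bq] := rank_in_surj r qS.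
by exists a, b; split=> //; rewrite /swap_ranks (item_atE aS aq) (item_atE bS bq).
Qed.

Lemma tperm_stable (a b x : 'I_p) : a \in S -> b \in S ->
  (tperm a b x \in S) = (x \in S).
Proof. by move=> aS bS; case: tpermP => [->|->|]; rewrite ?aS ?bS. Qed.

Lemma swap_ranksK : involutive (@swap_ranks p q S).
Proof.
move=> r; have [a [b [aS bS aq bq ->]]] := swap_ranksP r.
have tS x := tperm_stable x aS bS.
rewrite /swap_ranks (item_atE bS) ?(item_atE aS) ?rank_in_mul ?tpermL ?tpermR //.
by rewrite mulgA (tpermC b a) tperm2 mul1g.
Qed.

Lemma rank_in_swap_ranks (r : pref p) o : o \in S ->
  (rank_in (swap_ranks q S r) S o == q) = (rank_in r S o == q.+1).
Proof.
move=> oS; have [a [b [aS bS aq bq ->]]] := swap_ranksP r.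
have tS x := tperm_stable x aS bS; rewrite rank_in_mul //.
rewrite -{1}aq -bq !(inj_in_eq (@rank_in_inj _ r S)) ?tS //.
by rewrite -{2}(tpermR a b) (inj_eq perm_inj).
Qed.

(** With [o] of rank [q.+1] removed, the only item of [S] that moves is the one of rank [q]. It
    takes the position of [o], and passes no item of [S] on the way because the ranks are
    consecutive. *)
Lemma agree_on_swap_ranks (r : pref p) o : o \in S -> rank_in r S o = q.+1 ->
  agree_on (S :\ o) (swap_ranks q S r) r.
Proof.
move=> oS oq; have [a [b [aS bS aq bq ->]]] := swap_ranksP r.
have {o oS oq} -> : o = b by apply: (rank_in_inj r oS bS); rewrite bq.
move=> x y; rewrite !inE !permM => /andP[xb xS] /andP[yb yS].
(* No item of [S] lies strictly between [a] and [b], so [z] compares alike with both. *)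
have ltb z : z \in S -> z != b -> z != a ->
    ((r b < r z) = (r a < r z))%N /\ ((r z < r b) = (r z < r a))%N.
  move=> zS zb za; rewrite -!(rank_in_mono r (S := S)) // aq bq.
  have: rank_in r S z != q by rewrite -aq (inj_in_eq (@rank_in_inj _ r S)).
  have: rank_in r S z != q.+1 by rewrite -bq (inj_in_eq (@rank_in_inj _ r S)).
  by rewrite ltnS; case: ltngtP => // h1; case: ltngtP.
case: (tpermP a b x) => [->|/eqP|/eqP xa _]; rewrite ?(negbTE xb) //;
  case: (tpermP a b y) => [->|/eqP|/eqP ya _]; rewrite ?(negbTE yb) ?ltnn //.
- by have [] := ltb y yS yb ya.
- by have [] := ltb x xS xb xa.
Qed.

End SwapRanks.

(* No restriction on how X depends on the orders of the agents other than j. *)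
Definition depends_on n p (T : Type) (j : 'I_n) (S : {set 'I_p})
    (X : profile n p -> T) : Prop :=
  forall R R' : profile n p, (forall k, k != j -> R k = R' k) ->
    agree_on S (R j) (R' j) -> X R = X R'.

(* Exchanging the items of ranks q and q+1 in S is an involution on profiles which
   preserves X on those where o has one of these ranks. *)
Lemma rank_in_uniform n p (j : 'I_n) (S : {set 'I_p}) o q
    (X : profile n p -> rat) :
  o \in S -> (q < #|S|)%N -> depends_on j (S :\ o) X ->
  \sum_(R : profile n p | rank_in (R j) S o == q) X R = (\sum_R X R) / #|S|%:R.
Proof.
move=> oS + XS; pose A k := \sum_(R : profile n p | rank_in (R j) S o == k) X R.
have AS k : (k.+1 < #|S|)%N -> A k = A k.+1.
  move=> kS; pose h (R : profile n p) : profile n p :=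
    [ffun l => if l == j then swap_ranks k S (R l) else R l].
  have hK : involutive h.
    move=> R; apply/ffunP => l; rewrite !ffunE.
    by case: eqP => // _; rewrite swap_ranksK.
  rewrite /A (reindex_inj (inv_inj hK)); apply: eq_big => R.
    by rewrite ffunE eqxx rank_in_swap_ranks.
  rewrite ffunE eqxx rank_in_swap_ranks // => /eqP oq.
  apply: XS => [l lj|]; first by rewrite ffunE (negbTE lj).
  by rewrite ffunE eqxx; apply: agree_on_swap_ranks.
have A0 k : (k < #|S|)%N -> A k = A 0%N.
  by elim: k => // k IH kS; rewrite -AS // IH // ltnW.
move=> qS; rewrite -/(A q) A0 //.
(* The possible ranks of [o] split the profiles into [#|S|] classes, on which [X] has equal sums by
   [A0]. *)
suff -> : \sum_R X R = A 0%N * #|S|%:R.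
  by rewrite mulfK // pnatr_eq0 -lt0n (leq_trans _ qS).
rewrite (partition_big (fun R : profile n p => Ordinal (rank_in_lt (R j) oS)) xpredT) //=.
rewrite mulr_natr -[in RHS](card_ord #|S|) -sumr_const.
by apply: eq_bigr => k _; rewrite -(A0 k) // /A; apply: eq_bigl => R; rewrite -val_eqE.
Qed.

(** * Bundles and the expected utility of an agent *)

Lemma bundle_sub n p (R : profile n p) i (S : {set 'I_p}) s : bundle R i S s \subset S.
Proof.
elim: s S => [|j s IH] S /=; first exact: sub0set.
rewrite /top_item; case: pickP => [o /andP[oS _]|_]; last exact: sub0set.
rewrite subUset (subset_trans (IH _)) ?subD1set // andbT.
by case: ifP; rewrite ?sub0set // sub1set.
Qed.

Lemma agree_on_bundle n p (R R' : profile n p) i (S : {set 'I_p}) s :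
  (forall k, agree_on S (R k) (R' k)) -> bundle R i S s = bundle R' i S s.
Proof.
elim: s S => //= j s IH S RS.
have -> : top_item (R j) S = top_item (R' j) S.
  apply: eq_pick => o; case oS: (o \in S) => //=.
  apply: eq_forallb => x; case xS: (x \in S) => //=.
  by rewrite /position !ltnS [LHS]leqNgt [RHS]leqNgt RS.
case: top_item => // o; rewrite IH // => k x y /setD1P[_ xS] /setD1P[_ yS].
exact: RS.
Qed.

Lemma top_itemE p (r : pref p) (S : {set 'I_p}) o :
  o \in S -> rank_in r S o = 0%N -> top_item r S = Some o.
Proof.
move=> oS o0.
have le_o x : x \in S -> (r o <= r x)%N.
  by move=> xS; rewrite leqNgt -(rank_in_mono r o xS) o0.
rewrite /top_item; case: pickP => [x /andP[xS /forall_inP xmin]|/(_ o)/=].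
  congr Some; apply: (@perm_inj _ r); apply: ord_inj; apply/eqP.
  by rewrite eqn_leq le_o // andbT; apply: xmin.
by rewrite oS /= => /forall_inP[]; exact: le_o.
Qed.

(** This expresses whether [o] beats [x] through the rank of [o] and the order on [S :\ o] alone,
    two data that are independent for a random order. *)
Lemma rank_in_D1_lt p (r : pref p) (S : {set 'I_p}) o x : o \in S -> x \in S :\ o ->
  (r o < r x)%N = (rank_in r S o <= rank_in r (S :\ o) x)%N.
Proof.
move=> oS /setD1P[xo xS].
have: rank_in r S x != rank_in r S o by rewrite (inj_in_eq (@rank_in_inj _ r S)).
have := rank_in_mono r x oS; rewrite (rank_inD1 r x oS).
case: (r o < r x)%N => /=; first by rewrite add1n ltnS.
rewrite add0n => le_ox ne_xo.
by rewrite leq_eqVlt le_ox orbF eq_sym (negbTE ne_xo).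
Qed.

(** Each profile has exactly one item of rank [q] in [S]. With [q = 0] this splits the profiles by
    the item picked first. *)
Lemma sum_rank_in n p (j : 'I_n) (S : {set 'I_p}) q (X : profile n p -> rat) :
  (q < #|S|)%N ->
  \sum_R X R = \sum_(o in S) \sum_(R : profile n p | rank_in (R j) S o == q) X R.
Proof.
move=> qS; rewrite (exchange_big_dep xpredT) //=; apply: eq_bigr => R _.
have [o oS oq] := rank_in_surj (R j) qS.
rewrite (big_pred1 o) // => x /=; case xS: (x \in S) => /=.
  by rewrite -oq (inj_in_eq (@rank_in_inj _ (R j) S)).
by apply/esym/negbTE; apply: contraFneq xS => ->.
Qed.

(** Let [m = #|S|] and let [x] have rank [k] in [S :\ o]. Since [o] has uniform rank in [S], it
    precedes [x] in [k + 1] of [m] cases, so the mean of [m - rank_in (R i) S x] is [m - k - (k + 1)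
    / m = (m + 1) / m * (m - 1 - k)]. *)
Lemma expected_rank_sum n p (i : 'I_n) (S : {set 'I_p}) o (B : profile n p -> {set 'I_p}) :
  o \in S -> (forall R, B R \subset S :\ o) ->
  depends_on i (S :\ o) B ->
  \sum_R \sum_(x in B R) (#|S|%:R - (rank_in (R i) S x)%:R) =
    (#|S|.+1)%:R / #|S|%:R *
    \sum_R \sum_(x in B R) (#|S :\ o|%:R - (rank_in (R i) (S :\ o) x)%:R) :> rat.
Proof.
move=> oS BS Bdep; set m := #|S|.
have Sm : m = #|S :\ o|.+1 by rewrite /m (cardsD1 o S) oS.
(* The inner sum as it would be if [o] had rank [q]; unlike the original, it depends only on the
   order of [i] on [S :\ o]. *)
pose K q (R : profile n p) : rat := \sum_(x in B R)
  (m%:R - (q <= rank_in (R i) (S :\ o) x)%N%:R - (rank_in (R i) (S :\ o) x)%:R).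
transitivity (\sum_(q < m) \sum_(R : profile n p | rank_in (R i) S o == q) K q R).
  rewrite (partition_big (fun R : profile n p => Ordinal (rank_in_lt (R i) oS)) xpredT) //=.
  apply: eq_bigr => q _; apply: eq_big => [R|R /eqP <-]; first by rewrite -val_eqE.
  apply: eq_bigr => x /(subsetP (BS R)) xS.
  by rewrite (rank_inD1 _ _ oS) (rank_in_D1_lt _ oS xS) natrD opprD addrA.
under eq_bigr => q _.
  rewrite rank_in_uniform //; last first.
    move=> R R' RR' RRi; rewrite /K (Bdep R R') //; apply: eq_bigr => x.
    move/(subsetP (BS R')) => xS; rewrite (agree_on_rank_in RRi) //.
  over.
rewrite -mulr_suml exchange_big /= mulrAC mulr_sumr; congr (_ / _).
apply: eq_bigr => R _; rewrite /K exchange_big mulr_sumr /=.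
apply: eq_bigr => x /(subsetP (BS R)) xS; set k := rank_in _ _ x.
have km : (k < m)%N by rewrite Sm ltnW // ltnS rank_in_lt.
rewrite !sumrB !sumr_const card_ord -natr_sum.
have -> : (\sum_(q < m) (q <= k) = k.+1)%N.
  rewrite -[RHS]card_ord -sum1_card (big_ord_widen m (fun=> 1%N)) // [RHS]big_mkcond.
  by apply: eq_bigr => q _; rewrite ltnS; case: leqP.
rewrite -[m%:R *+ m]mulr_natr -[k%:R *+ m]mulr_natr -[k.+1%:R]natr1 -[m.+1%:R]natr1 Sm -[_.+1%:R]natr1.
ring.
Qed.

(** For the induction on picks, Borda utility is measured relative to the remaining items, as [#|S|]
    minus the rank in [S]; the full set gives back the original utility. *)
Lemma sum_utility n p (i : 'I_n) (S : {set 'I_p}) (s : seq 'I_n) : size s = #|S| ->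
  \sum_(R : profile n p) \sum_(o in bundle R i S s) (#|S|%:R - (rank_in (R i) S o)%:R) =
    #|{: profile n p}|%:R * #|S|.+1%:R * share i s.
Proof.
elim: s S => [|j s IH] S szS.
  by rewrite mulr0 big1 // => R _; rewrite big_set0.
rewrite /= in szS; have S0 : (0 < #|S|)%N by rewrite -szS.
have m0 : #|S|%:R != 0 :> rat by rewrite pnatr_eq0 -lt0n.
have bundleE (R : profile n p) o : o \in S -> rank_in (R j) S o == 0%N ->
    bundle R i S (j :: s) =
    (if j == i then [set o] else set0) :|: bundle R i (S :\ o) s.
  by move=> oS /eqP o0; rewrite /= (top_itemE oS o0).
have sub_bundle (R : profile n p) o : bundle R i (S :\ o) s \subset S :\ o by apply: bundle_sub.
have szSo o : o \in S -> size s = #|S :\ o|.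
  by move=> oS; apply: succn_inj; rewrite szS (cardsD1 o S) oS.
have dep_bundle o k : depends_on k (S :\ o) (fun R => bundle R i (S :\ o) s).
  move=> R R' RR' RRk; apply: agree_on_bundle => l.
  by have [->|/RR' ->] := eqVneq l k.
rewrite (sum_rank_in j _ S0) [share _ _]/=; case: eqVneq bundleE => [ji|ji] bundleE.
- subst i.
  (* The top item [o] is worth [#|S|] to its picker. Removing it lowers both the size and the rank
     of each later item by one, which leaves their values unchanged. *)
  transitivity (\sum_(o in S) \sum_(R : profile n p | rank_in (R j) S o == 0%N)
    (#|S|%:R + \sum_(x in bundle R j (S :\ o) s)
      (#|S :\ o|%:R - (rank_in (R j) (S :\ o) x)%:R)) : rat).
    apply: eq_bigr => o oS; apply: eq_bigr => R o0; rewrite (bundleE _ _ oS o0) big_setU1 /=; last first.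
      by apply/negP => /(subsetP (sub_bundle R o)); rewrite !inE eqxx.
    rewrite (eqP o0) subr0; congr (_ + _); apply: eq_bigr => x /(subsetP (sub_bundle R o)) xS.
    rewrite (rank_inD1 _ _ oS) (rank_in_D1_lt _ oS xS) (eqP o0) leq0n (cardsD1 o S) oS.
    by rewrite !natrD; ring.
  under eq_bigr => o oS.
    rewrite rank_in_uniform //; last first.
      move=> R R' RR' RRj; rewrite (dep_bundle o j R R') //; congr (_ + _).
      apply: eq_bigr => x /(subsetP (sub_bundle R' o)) xS.
      by rewrite (agree_on_rank_in RRj).
    rewrite big_split /= sumr_const IH -?szSo // szS -mulr_natl.
    over.
  rewrite sumr_const -mulr_natr /shrink szS.
  have m1 : #|S|.+1%:R != 0 :> rat by rewrite pnatr_eq0.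
  by field; rewrite m0 addrC natr1 m1.
(* Here [o] is top for [j] but has arbitrary rank for [i]. The order of [j] is averaged first, then
   [expected_rank_sum] averages over that of [i]. *)
- transitivity (\sum_(o in S) \sum_(R : profile n p | rank_in (R j) S o == 0%N)
    (\sum_(x in bundle R i (S :\ o) s) (#|S|%:R - (rank_in (R i) S x)%:R)) : rat).
    apply: eq_bigr => o oS; apply: eq_bigr => R o0.
    by rewrite (bundleE _ _ oS o0) set0U.
  under eq_bigr => o oS.
    rewrite rank_in_uniform //; last first.
      move=> R R' RR' RRj; rewrite (dep_bundle o j R R') //.
      by rewrite RR' // eq_sym.
    rewrite (expected_rank_sum oS (fun R => sub_bundle R o) (dep_bundle o i)).
    rewrite IH -?szSo // szS.
    over.
  rewrite sumr_const -mulr_natr.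
  by field; rewrite m0.
Qed.

(** * Maximising weighted welfare for two agents *)

Lemma shrink_ge0 k : 0 <= shrink k.
Proof. by rewrite divr_ge0 ?ler0n. Qed.

Lemma shrink_le1 k : shrink k <= 1.
Proof. by rewrite ler_pdivrMr ?ltr0n // mul1r ler_nat. Qed.

Lemma shrink_leS k : shrink k <= shrink k.+1.
Proof.
rewrite ler_pdivrMr ?ltr0n // mulrAC ler_pdivlMr ?ltr0n //.
rewrite -[k.+2%:R]natr1 -natr1; lra.
Qed.

Lemma share_ge0 n (i : 'I_n) s : 0 <= share i s.
Proof.
elim: s => //= j s IH; case: ifP => // _.
by rewrite mulr_ge0 ?shrink_ge0 // addr_ge0.
Qed.

Notation flip := (@rev_ord 2).

Lemma flip_eqF i : (flip i == i) = false.
Proof. by case: i => [[|[|[]]]]. Qed.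

Lemma flip_or (i j : 'I_2) : j = i \/ j = flip i.
Proof.
by case: i j => [[|[|//]] ?] [[|[|//]] ?]; [left|right|right|left]; apply: val_inj.
Qed.

Lemma share_flip i s : share (flip i) (map flip s) = share i s.
Proof.
elim: s => //= j s ->; rewrite size_map.
by rewrite (inj_eq rev_ord_inj).
Qed.

(** The weights record the factors due to picks already made. Taking agent [i] as reference lets the
    two agents exchange roles. *)
Definition welfare (a b : rat) (i : 'I_2) (s : seq 'I_2) : rat :=
  a * share i s + b * share (flip i) s.

Lemma welfare_flip a b i s : welfare a b i s = welfare b a (flip i) s.
Proof. by rewrite /welfare rev_ordK addrC. Qed.

Lemma welfare_cons a b i s : welfare a b i (i :: s) =
  a * shrink (size s).+1 + welfare (a * shrink (size s).+1) b i s.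
Proof. by rewrite /welfare /= eqxx eq_sym flip_eqF; ring. Qed.

Lemma welfare_consF a b i s : welfare a b i (flip i :: s) =
  b * shrink (size s).+1 + welfare a (b * shrink (size s).+1) i s.
Proof. by rewrite welfare_flip welfare_cons -welfare_flip. Qed.

Lemma heavier_picks_first a b i j t : 0 <= b -> b <= a ->
  exists2 s, size s = size t & welfare a b i (j :: t) <= welfare a b i (i :: s).
Proof.
elim: t b j => [|k t IH] b j b0 ba; case: (flip_or i j) => ->;
  try by [exists [::] | exists (k :: t)].
  exists [::] => //; rewrite welfare_consF welfare_cons /welfare /=.
  by rewrite !mulr0 !addr0 ler_wpM2r ?shrink_ge0.
have bc0 : 0 <= b * shrink (size t).+2 by rewrite mulr_ge0 ?shrink_ge0.
have bca : b * shrink (size t).+2 <= a.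
  by apply: le_trans ba; rewrite ler_piMr ?shrink_le1.
have [s szs le_ts] := IH _ k bc0 bca.
rewrite welfare_consF /=.
(* By induction [i] may be taken to pick second. It remains to exchange the first two picks, giving
   the tail with the larger share to [i]. *)
suff [s' szs' les'] : exists2 s', size s' = size s &
    b * shrink (size t).+2 + welfare a (b * shrink (size t).+2) i (i :: s)
    <= welfare a b i [:: i, flip i & s'].
  exists (flip i :: s'); first by rewrite /= szs' szs.
  by apply: le_trans les'; rewrite lerD2l.
move: (shrink_leS (size s).+1) (shrink_ge0 (size s).+1) => cd c0.
move: (share_ge0 i s) (share_ge0 (flip i) s) => x0 y0.
case: (lerP (share (flip i) s) (share i s)) => gg;
  [exists s => // | exists (map flip s); first by rewrite size_map];
  rewrite !(welfare_cons, welfare_consF) /= /welfare ?size_map -szs.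
(* This product is exactly the gain from the exchange with the tail kept; the one in the next case
   is the gain with the tail flipped. *)
- have: 0 <= (shrink (size s).+2 - shrink (size s).+1) *
      (a * (1 + share i s) - b * (1 + share (flip i) s)).
    apply: mulr_ge0; first by rewrite subr_ge0.
    by rewrite subr_ge0 ler_pM // ?lerD2l // addr_ge0.
  lra.
- have Ei : share i (map flip s) = share (flip i) s.
    by rewrite -{1}[i]rev_ordK share_flip.
  rewrite share_flip Ei.
  have: 0 <= (a - b) * (shrink (size s).+2 * (1 + share (flip i) s) -
      shrink (size s).+1 * (1 + share i s)).
    apply: mulr_ge0; first by rewrite subr_ge0.
    by rewrite subr_ge0 ler_pM // ?lerD2l ?(ltW gg) // addr_ge0.
  lra.
Qed.

Fixpoint alternate (i : 'I_2) (n : nat) : seq 'I_2 :=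
  if n is n'.+1 then i :: alternate (flip i) n' else [::].

Lemma size_alternate i n : size (alternate i n) = n.
Proof. by elim: n i => //= n IH i; rewrite IH. Qed.

Lemma alternate_optimal a b i t : 0 <= a -> a * shrink (size t) <= b <= a ->
  welfare a b i t <= welfare a b i (alternate i (size t)).
Proof.
move: {2}(size t) (erefl (size t)) => n.
elim: n a b i t => [|n IH] a b i [|j t] // [szt] a0 /andP[cab ba].
have b0 : 0 <= b by apply: le_trans cab; rewrite mulr_ge0 ?shrink_ge0.
have [s szs /le_trans-> //] := heavier_picks_first i j t b0 ba.
rewrite /= !welfare_cons size_alternate szs lerD2l.
rewrite ![welfare _ b i _]welfare_flip -szs; apply: IH => //; first by rewrite szs.
rewrite szs cab andbT.
(* After the pick the heavier weight is [b] and the lighter one [a * shrink (size t).+1]; the lower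
   bound for the next round follows from [b <= a] and monotonicity of [shrink]. *)
apply: le_trans (_ : a * shrink (size t) <= _).
  by rewrite ler_wpM2r ?shrink_ge0.
by rewrite ler_wpM2l ?shrink_leS.
Qed.

(** * Return to policies and expected welfare *)

Lemma alternating_alternate p : alternating p = alternate ord0 p :> seq 'I_2.
Proof.
apply: (@eq_from_nth _ ord0); first by rewrite size_tuple size_alternate.
move=> k; rewrite size_tuple => kp.
rewrite -[k]/(nat_of_ord (Ordinal kp)) -tnth_nth tnth_mktuple /=.
have -> : forall i : 'I_2, nth ord0 (alternate i p) k = if odd k then flip i else i.
  elim: p k kp => // p IH [|k] //= kp i.
  by rewrite IH //; case: (odd k) => //=; rewrite rev_ordK.
by apply: val_inj; rewrite modn2 /= inordK; case: (odd k).
Qed.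

Lemma expected_utility_share n p (i : 'I_n) (pi : policy n p) :
  expected_utility (@full_independence n p) (borda p) i pi = p.+1%:R * share i pi.
Proof.
pose mu : rat := \prod_(k < n) (p`!)%:R^-1.
have mu_total : mu * #|{: profile n p}|%:R = 1.
  rewrite /mu prodr_const card_ord card_ffun card_ord card_Sn natrX exprVn mulVf //.
  by rewrite expf_neq0 // pnatr_eq0 -lt0n fact_gt0.
rewrite /expected_utility /expectation /full_independence -/mu -mulr_sumr.
transitivity (mu * (#|{: profile n p}|%:R * p.+1%:R * share i pi)); last first.
  by rewrite !mulrA mu_total mul1r.
congr (_ * _).
have := sum_utility i (S := [set: 'I_p]) (s := pi).
rewrite size_tuple cardsT card_ord => /(_ erefl) <-.
apply: eq_bigr => R _; apply: eq_bigr => o _.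
(* The [+ 1] in [borda] cancels the shift to positions counted from 1. *)
by rewrite rank_in_setT /borda /position -natr1; ring.
Qed.

Theorem theorem1 (p : nat) (hp : (1 <= p)%N) (pi : policy 2 p) :
  expected_sw (@full_independence 2 p) (borda p) pi
    <= expected_sw (@full_independence 2 p) (borda p) (alternating p).
Proof.
have swE (s : policy 2 p) : expected_sw (@full_independence 2 p) (borda p) s =
    p.+1%:R * welfare 1 1 ord0 s.
  rewrite /expected_sw !big_ord_recl big_ord0 !expected_utility_share addr0 -mulrDr.
  by rewrite /welfare !mul1r; congr (_ * (_ + share _ _)); apply: val_inj.
rewrite !swE ler_wpM2l // alternating_alternate.
(* Equal weights meet the condition of [alternate_optimal] because [shrink p <= 1]. *)
have := @alternate_optimal 1 1 ord0 pi; rewrite size_tuple; apply=> //.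
by rewrite mul1r shrink_le1 lexx.
Qed.
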